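(* Let $n\in\mathbb{N}^\ast$. For every $\mathbf{a}\in\boldsymbol{\mathcal{A}}$, the matrix $T\rho(\mathbf{a})$ is symmetric.
   Context: Notation. $\mathbb{N}^\ast=\{1,2,3,\dots\}$; $[x]$ is the integer part. Fix $n\in\mathbb{N}^\ast$. Define on $\mathbb{N}^\ast$ the equivalence relation $i\,\mathcal{R}\,j\iff[n/i]=[n/j]$. Its classes are intervals; exactly one is unbounded, namely $\widehat{\infty}=\{m: m>n\}$. $\mathcal{S}$ is the finite set of largest elements of the bounded classes, with its natural order, and $s=\#\mathcal{S}$. $\mathcal{R}$ is compatible with multiplication, so one can define the following commutative $\mathbb{Z}$-algebra $\boldsymbol{\mathcal{A}}$. It is the free $\mathbb{Z}$-module with basis $(\mathbf{k})_{k\in\mathcal{S}}$, with bilinear multiplication given, for $i,j\in\mathcal{S}$, by $\mathbf{i}\,\mathbf{j}=\mathbf{l}$, where $l\in\mathcal{S}$ is the largest element of the class of the integer $ij$, if $ij\le n$, and $\mathbf{i}\,\mathbf{j}=0$ if $ij>n$. (Equivalently, $\boldsymbol{\mathcal{A}}$ is the quotient of the $\mathbb{Z}$-algebra of the monoid $\mathbb{N}^\ast/\mathcal{R}$ by the ideal $\mathbb{Z}\widehat{\infty}$.) For $\mathbf{a}\in\boldsymbol{\mathcal{A}}$, $\rho(\mathbf{a})$ is the $s\times s$ matrix (rows and columns indexed by $\mathcal{S}$) of the linear map $\mathbf{x}\mapsto\mathbf{a}\mathbf{x}$ in the basis $(\mathbf{k})_{k\in\mathcal{S}}$; its column of index $j$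 holds the coordinates of $\mathbf{a}\,\mathbf{j}$. $T$ is the symmetric $s\times s$ matrix whose entry in position $(p,q)$, $1\le p,q\le s$, is $1$ if $p+q\le s+1$ (on or above the antidiagonal) and $0$ otherwise; its rows and columns are also indexed by $\mathcal{S}$ in increasing order. *)

(* Defs.v *)
From HB Require Import structures.
From mathcomp Require Import all_boot all_order all_algebra.

Set Implicit Arguments.
Unset Strict Implicit.
Unset Printing Implicit Defensive.

Import GRing.Theory.

(* Only meaningful on positive integers: divn gives n %/ 0 = 0. *)
Definition Rel (n : nat) : rel nat := fun i j => n %/ i == n %/ j.

(* An element of a bounded class is <= n, so it suffices to let k and the
   competing elements m of its class range over 1 .. n; see SeqSP. *)
Definition SeqS (n : nat) : seq nat :=
  [seq k <- iota 1 n | all (fun m => Rel n m k ==> (m <= k)) (iota 1 n)].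

Definition sizeS (n : nat) : nat := size (SeqS n).

(* The element of rank i (from 0) of S in increasing order. *)
Definition eltS (n : nat) (i : 'I_(sizeS n)) : nat := nth 0 (SeqS n) i.

(* The largest element of the class of m, for 1 <= m <= n. *)
Definition topcl (n m : nat) : nat :=
  \max_(k < n.+1 | (0 < k) && Rel n k m) k.

Lemma Rel_leq n i j : 0 < i -> 0 < j -> Rel n i j -> (i <= n) = (j <= n).
Proof.
move=> i0 j0 /eqP e.
by rewrite -(divn_gt0 n i0) e divn_gt0.
Qed.

Lemma SeqSP n k :
  reflect [/\ 0 < k,
              (exists b, forall m, 0 < m -> Rel n m k -> m <= b)
            & forall m, 0 < m -> Rel n m k -> m <= k]
          (k \in SeqS n).
Proof.
rewrite mem_filter mem_iota add1n ltnS.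
apply: (iffP and3P) => [[/allP h k0 kn]|[k0 _ h]].
  have hk m : 0 < m -> Rel n m k -> m <= k.
    move=> m0 r; move: (h m); rewrite mem_iota add1n ltnS m0 /=.
    by rewrite (Rel_leq m0 k0 r) kn r => /(_ isT).
  by split=> //; exists k.
have kn : k <= n.
  rewrite leqNgt; apply/negP => nk; have := h k.+1 isT.
  rewrite /Rel !divn_small ?ltnn => // [/(_ isT)//|].
  exact: ltnW.
split=> //; apply/allP => m; rewrite mem_iota => /andP[m0 _].
by apply/implyP/h.
Qed.

Lemma SeqS_sorted n : sorted ltn (SeqS n).
Proof. exact/sorted_filter/iota_ltn_sorted/ltn_trans. Qed.

Lemma eltS_in n (i : 'I_(sizeS n)) : eltS i \in SeqS n.
Proof. exact: mem_nth. Qed.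

Lemma eltS_gt0 n (i : 'I_(sizeS n)) : 0 < eltS i.
Proof. by case/SeqSP: (eltS_in i). Qed.

Lemma eltS_leq n (i : 'I_(sizeS n)) : eltS i <= n.
Proof. by have := eltS_in i; rewrite mem_filter mem_iota add1n ltnS => /and3P[]. Qed.

Lemma eltS_inj n : injective (@eltS n).
Proof.
move=> i j /eqP; rewrite nth_uniq //; first by move/eqP/val_inj.
exact: filter_uniq (iota_uniq _ _).
Qed.

Lemma eltS_ex n k : k \in SeqS n -> exists i : 'I_(sizeS n), eltS i = k.
Proof.
by move=> kS; have ks := kS; rewrite -index_mem in ks; exists (Ordinal ks); exact: nth_index.
Qed.

Lemma topclP n m : 0 < m <= n ->
  [/\ topcl n m \in SeqS n, Rel n (topcl n m) m
    & forall k, 0 < k -> Rel n k m -> k <= topcl n m].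
Proof.
move=> /andP[m0 mn].
have hmax k : 0 < k -> Rel n k m -> k <= topcl n m.
  move=> k0 r; have kn : k < n.+1 by rewrite ltnS (Rel_leq k0 m0 r).
  by rewrite /topcl (bigD1 (Ordinal kn)) ?k0 //= leq_maxl.
have [t0 tr] : 0 < topcl n m /\ Rel n (topcl n m) m.
  rewrite /topcl; have mn' : m < n.+1 by rewrite ltnS.
  have [|j] := @eq_bigmax_cond _ [pred k : 'I_n.+1 | (0 < k) && Rel n k m] (@nat_of_ord n.+1).
    by apply/card_gt0P; exists (Ordinal mn'); rewrite inE /= m0 /Rel /=.
  by rewrite inE => /andP[j0 jr] ->.
split=> //; apply/SeqSP; have h k : 0 < k -> Rel n k (topcl n m) -> k <= topcl n m.
  by move=> k0 r; apply: hmax => //; rewrite /Rel (eqP r).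
by split=> //; exists (topcl n m).
Qed.

Local Open Scope ring_scope.

(* Column vectors of coordinates in the basis (k)_{k in S}.  The alias keeps
   the multiplication below apart from any matrix multiplication. *)
Definition algA (n : nat) : Type := 'cV[int]_(sizeS n).

HB.instance Definition _ (n : nat) := GRing.Lmodule.copy (algA n) 'cV[int]_(sizeS n).

Definition basisA (n : nat) (i : 'I_(sizeS n)) : algA n := delta_mx i 0.

Definition coordA (n : nat) (a : algA n) (i : 'I_(sizeS n)) : int :=
  (a : 'cV[int]_(sizeS n)) i 0.

(* The image in the algebra of the positive integer m: the sum has exactly one
   term, and is k for k the largest element of the class of m; see clsA_ex. *)
Definition clsA (n m : nat) : algA n :=
  if (m <= n)%N then \sum_(i | eltS i == topcl n m) basisA i else 0.

Definition mulA (n : nat) (a b : algA n) : algA n :=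
  \sum_i \sum_j (coordA a i * coordA b j) *: clsA n (eltS i * eltS j).

Definition oneA (n : nat) : algA n := clsA n 1.

Lemma coordAD n (a b : algA n) i : coordA (a + b) i = coordA a i + coordA b i.
Proof. by rewrite /coordA mxE. Qed.

Lemma coordAZ n c (a : algA n) i : coordA (c *: a) i = c * coordA a i.
Proof. by rewrite /coordA mxE. Qed.

Lemma coordA_basis n (i j : 'I_(sizeS n)) : coordA (basisA j) i = (i == j)%:R.
Proof. by rewrite /coordA mxE eqxx andbT. Qed.

Lemma algA_decomp n (a : algA n) : a = \sum_i coordA a i *: basisA i.
Proof.
apply/matrixP => i j; rewrite ord1 summxE (bigD1 i) //= !mxE !eqxx mulr1.
by rewrite big1 ?addr0 // => k ki; rewrite !mxE eq_sym (negPf ki) mulr0.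
Qed.

Lemma clsA_eltS n (i : 'I_(sizeS n)) m :
  (0 < m)%N -> Rel n (eltS i) m -> clsA n m = basisA i.
Proof.
move=> m0 r; have mn : (m <= n)%N by rewrite -(Rel_leq (eltS_gt0 i) m0 r) eltS_leq.
have [_ tr tmax] := topclP (introT andP (conj m0 mn)).
rewrite /clsA mn (big_pred1 i) // => j /=; rewrite -(inj_eq (@eltS_inj n)); congr (_ == _).
apply/eqP; rewrite eqn_leq (tmax _ (eltS_gt0 _) r) andbT.
have [_ _ imax] := SeqSP _ _ (eltS_in i); apply: imax; last by rewrite /Rel (eqP tr) eq_sym.
exact: leq_trans (eltS_gt0 i) (tmax _ (eltS_gt0 i) r).
Qed.

Lemma clsA_gt n m : (n < m)%N -> clsA n m = 0.
Proof. by rewrite /clsA ltnNge => /negPf ->. Qed.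

Lemma clsA_ex n m : (0 < m <= n)%N -> exists2 i : 'I_(sizeS n), Rel n (eltS i) m & clsA n m = basisA i.
Proof.
move=> mn; have [tS tr _] := topclP mn; have [i ei] := eltS_ex tS.
have r : Rel n (eltS i) m by rewrite ei.
by exists i => //; apply: clsA_eltS => //; case/andP: mn.
Qed.

Lemma mulA_is_C n : commutative (@mulA n).
Proof.
move=> a b; rewrite /mulA exchange_big; apply: eq_bigr => i _; apply: eq_bigr => j _.
by rewrite mulrC mulnC.
Qed.

Lemma mulA_is_Dl n : left_distributive (@mulA n) +%R.
Proof.
move=> a b c; rewrite /mulA -big_split; apply: eq_bigr => i _ /=.
rewrite -big_split; apply: eq_bigr => j _ /=.
by rewrite coordAD mulrDl scalerDl.
Qed.

Lemma mulA_is_Zl n c (a b : algA n) : c *: mulA a b = mulA (c *: a) b.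
Proof.
rewrite /mulA scaler_sumr; apply: eq_bigr => i _; rewrite scaler_sumr.
by apply: eq_bigr => j _; rewrite coordAZ scalerA mulrA.
Qed.

Lemma mulA_is_0l n (b : algA n) : mulA 0 b = 0.
Proof. by rewrite -(scale0r (0 : algA n)) -mulA_is_Zl !scale0r. Qed.

Lemma mulA_suml n I (r : seq I) (F : I -> algA n) b :
  mulA (\sum_(i <- r) F i) b = \sum_(i <- r) mulA (F i) b.
Proof.
apply: (big_morph (fun a => mulA a b)) => [x y|]; first exact: mulA_is_Dl.
exact: mulA_is_0l.
Qed.

Lemma mulA_cls n m (b : algA n) : (0 < m)%N ->
  mulA (clsA n m) b = \sum_j coordA b j *: clsA n (m * eltS j).
Proof.
move=> m0; case: (leqP m n) => [mn|nm].
  have [i r ->] := clsA_ex (introT andP (conj m0 mn)).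
  rewrite /mulA (bigD1 i) //= [X in _ + X]big1 ?addr0 => [|k ki].
    apply: eq_bigr => j _; rewrite coordA_basis eqxx mul1r; congr (_ *: _).
    have rj : Rel n (eltS i * eltS j) (m * eltS j) by rewrite /Rel !divnMA (eqP r).
    have p0 : (0 < eltS i * eltS j)%N by rewrite muln_gt0 !eltS_gt0.
    have q0 : (0 < m * eltS j)%N by rewrite muln_gt0 m0 eltS_gt0.
    case: (leqP (eltS i * eltS j) n) => h; last first.
      by rewrite !clsA_gt // ltnNge -(Rel_leq p0 q0 rj) -ltnNge.
    have [k rk ->] := clsA_ex (introT andP (conj p0 h)).
    by rewrite (clsA_eltS q0 (i := k)) // /Rel (eqP rk).
  by apply: big1 => j _; rewrite coordA_basis (negPf ki) mul0r scale0r.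
rewrite clsA_gt // mulA_is_0l big1 // => j _.
by rewrite clsA_gt ?scaler0 // (leq_trans nm) // leq_pmulr ?eltS_gt0.
Qed.

Lemma mulA_is_A n : associative (@mulA n).
Proof.
have E (a b c : algA n) : mulA (mulA a b) c =
    \sum_i \sum_j \sum_k (coordA a i * coordA b j * coordA c k) *:
       clsA n (eltS i * eltS j * eltS k).
  rewrite {2}/mulA mulA_suml; apply: eq_bigr => i _; rewrite mulA_suml.
  apply: eq_bigr => j _; rewrite -mulA_is_Zl mulA_cls ?muln_gt0 ?eltS_gt0 //.
  by rewrite scaler_sumr; apply: eq_bigr => k _; rewrite scalerA.
move=> a b c; rewrite (mulA_is_C a) !E.
rewrite [RHS]exchange_big; apply: eq_bigr => i _.
rewrite [RHS]exchange_big; apply: eq_bigr => j _; apply: eq_bigr => k _.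
by congr (_ *: clsA _ _); [rewrite mulrC mulrA | rewrite mulnC mulnA].
Qed.

Lemma mulA_is_1l n : left_id (oneA n) (@mulA n).
Proof.
move=> a; rewrite [RHS]algA_decomp mulA_cls //; apply: eq_bigr => i _.
by rewrite mul1n (clsA_eltS (i := i)) ?eltS_gt0 ?/Rel.
Qed.

HB.instance Definition _ (n : nat) := GRing.Zmodule_isComPzRing.Build (algA n)
  (@mulA_is_A n) (@mulA_is_C n) (@mulA_is_1l n) (@mulA_is_Dl n).

(* The library's algebra structures require a nonzero ring, which would force
   0 < n; bilinearity of the product is therefore recorded separately. *)
Lemma algA_scaleAl n c (a b : algA n) : c *: (a * b) = (c *: a) * b.
Proof. exact: mulA_is_Zl. Qed.

Lemma algA_scaleAr n c (a b : algA n) : c *: (a * b) = a * (c *: b).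
Proof. by rewrite mulrC algA_scaleAl mulrC. Qed.

Lemma basisAM n (i j : 'I_(sizeS n)) : basisA i * basisA j = clsA n (eltS i * eltS j).
Proof.
rewrite -(clsA_eltS (i := i) (eltS_gt0 i)) ?/Rel //.
rewrite [LHS]mulA_cls ?eltS_gt0 // (bigD1 j) //= coordA_basis eqxx scale1r.
by rewrite big1 ?addr0 // => k kj; rewrite coordA_basis (negPf kj) scale0r.
Qed.

(* The entry (i, j) is the coordinate of index i of the product of a and the
   j-th basis element; rhoA_mul checks the orientation. *)
Definition rhoA (n : nat) (a : algA n) : 'M[int]_(sizeS n) :=
  \matrix_(i, j) coordA (a * basisA j) i.

Lemma rhoA_mul n (a x : algA n) : rhoA a *m (x : 'cV_(sizeS n)) = a * x.
Proof.
rewrite [in RHS](algA_decomp x) mulr_sumr; apply/matrixP => i k.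
rewrite ord1 summxE mxE; apply: eq_bigr => j _.
by rewrite -algA_scaleAr !mxE mulrC.
Qed.

(* With ranks counted from 1, the condition is p + q <= s + 1. *)
Definition matT (n : nat) : 'M[int]_(sizeS n) :=
  \matrix_(p, q) (p.+1 + q.+1 <= (sizeS n).+1)%N%:R.

(* Main.v *)
Require Import Defs.
From mathcomp Require Import all_boot all_order all_algebra.
Import GRing.Theory.

(** Let [phi] be the linear form on the algebra that sums the coordinates in
    the basis indexed by S.  It sends the class of a positive integer [m] to 1
    if [m <= n] and to 0 otherwise.  The statement holds because [T] is the Gram
    matrix of the symmetric bilinear form [(x, y) |-> phi (x * y)], that is,
    [T p q = 1] exactly when [eltS p * eltS q <= n] ([matT_gram]); then the
    entry [(p, q)] of [T * rho a] is [phi (p * a * q)] ([matT_rhoA]), which is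
    symmetric in [p] and [q] because the algebra is commutative.

    The arithmetic content is that [k |-> n %/ k] is a decreasing involution of
    S ([divn_involutive_SeqS], [SeqS_rev_divn]).  Hence it reverses ranks: the
    condition [eltS q <= n %/ eltS p] compares [q] with the rank opposite to
    that of [p], which is the antidiagonal condition defining [T]. *)

(** For [k, l > 0], the conditions [l <= n %/ k] and [k <= n %/ l] both say
    [k * l <= n], so [n %/ _] is an antitone Galois connection with itself; its
    image consists of closed elements, which are the elements of S. *)
Lemma divn_SeqS n k : 0 < k <= n -> n %/ k \in SeqS n.
Proof.
case/andP=> k_gt0 le_kn; have q_gt0 : 0 < n %/ k by rewrite divn_gt0.
have le_max m : 0 < m -> Rel n m (n %/ k) -> m <= n %/ k.
  move=> m_gt0 /eqP eq_m; rewrite leq_divRL // mulnC -leq_divRL // eq_m.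
  by rewrite leq_divRL // mulnC leq_divM.
by apply/SeqSP; split=> //; exists (n %/ k).
Qed.

Lemma SeqS_bounds {n k} : k \in SeqS n -> 0 < k <= n.
Proof. by case/eltS_ex=> i <-; rewrite eltS_gt0 eltS_leq. Qed.

(** By the Galois connection, [n %/ (n %/ k)] is at least [k] and in the class
    of [k], while [k] is the largest element of that class. *)
Lemma divn_involutive_SeqS {n k} : k \in SeqS n -> n %/ (n %/ k) = k.
Proof.
move=> kS; have /andP[k_gt0 le_kn] := SeqS_bounds kS.
have q_gt0 : 0 < n %/ k by rewrite divn_gt0.
have le_k : k <= n %/ (n %/ k) by rewrite leq_divRL // mulnC leq_divM.
have qq_gt0 := leq_trans k_gt0 le_k.
apply/eqP; rewrite eqn_leq le_k andbT.
case/SeqSP: kS => _ _; apply=> //; rewrite /Rel eqn_leq leq_div2l //=.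
by rewrite leq_divRL // mulnC leq_divM.
Qed.

(** A strictly decreasing bijection of a finite chain onto itself can only be
    the reversal: an increasing enumeration of S is unique. *)
Lemma SeqS_rev_divn n : rev [seq n %/ k | k <- SeqS n] = SeqS n.
Proof.
apply: (irr_sorted_eq ltn_trans ltnn) (SeqS_sorted n) _ => [|k].
  rewrite rev_sorted sorted_map.
  apply: (@sub_in_sorted _ [in SeqS n]) (SeqS_sorted n); last exact/allP.
  move=> i j iS jS /= lt_ij; have /andP[i_gt0 _] := SeqS_bounds iS.
  rewrite ltn_neqAle leq_div2l ?(ltnW lt_ij) // andbT.
  apply: contraTneq lt_ij => eq_q.
  by rewrite -(divn_involutive_SeqS iS) -eq_q divn_involutive_SeqS ?ltnn.
rewrite mem_rev; apply/mapP/idP => [[i iS ->]|kS].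
  exact/divn_SeqS/SeqS_bounds.
by exists (n %/ k); rewrite ?divn_involutive_SeqS ?divn_SeqS ?SeqS_bounds.
Qed.

Lemma divn_eltS n (p : 'I_(sizeS n)) : n %/ eltS p = eltS (rev_ord p).
Proof.
rewrite /eltS -{2}SeqS_rev_divn nth_rev size_map ?ltn_ord //.
have -> : size (SeqS n) - (rev_ord p).+1 = p.
  by rewrite -[in RHS](rev_ordK p).
by rewrite (nth_map 0) ?ltn_ord.
Qed.

Lemma leq_eltS n (p q : 'I_(sizeS n)) : (eltS p <= eltS q) = (p <= q).
Proof.
have lt_nth := sorted_ltn_nth ltn_trans 0 (SeqS_sorted n).
by apply: (leq_mono_in lt_nth); rewrite inE ltn_ord.
Qed.

Local Open Scope ring_scope.

Definition sum_coord {n} (a : algA n) : int := \sum_i coordA a i.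

Lemma sum_coord_cls n m : (0 < m)%N -> sum_coord (clsA n m) = (m <= n)%N%:R.
Proof.
move=> m_gt0; rewrite /sum_coord; case: leqP => [le_mn | lt_nm].
  have [|i _ ->] := @clsA_ex n m; first by rewrite m_gt0.
  rewrite (bigD1 i) //= coordA_basis eqxx big1 ?addr0 // => j /negPf ne_ji.
  by rewrite coordA_basis ne_ji.
by rewrite clsA_gt // big1 // => i _; rewrite /coordA mxE.
Qed.

(** Both sides test [eltS p * eltS q <= n]: on the left because this says
    [eltS q <= n %/ eltS p], and [n %/ eltS p] has the rank opposite to [p]. *)
Lemma matT_gram n (p q : 'I_(sizeS n)) :
  matT n p q = sum_coord (basisA p * basisA q).
Proof.
rewrite basisAM sum_coord_cls ?muln_gt0 ?eltS_gt0 // mxE; congr (nat_of_bool _)%:R.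
rewrite [in RHS]mulnC -leq_divRL ?eltS_gt0 // divn_eltS leq_eltS /=.
by rewrite addSn ltnS leq_subRL // addSn addnS.
Qed.

Lemma sum_coord_linear_comb n I (r : seq I) (c : I -> int) (F : I -> algA n) :
  sum_coord (\sum_(i <- r) c i *: F i) = \sum_(i <- r) c i * sum_coord (F i).
Proof.
rewrite /sum_coord; elim: r => [|i r IHr].
  by rewrite !big_nil big1 // => j _; rewrite /coordA mxE.
rewrite !big_cons -IHr mulr_sumr -big_split; apply: eq_bigr => j _.
by rewrite coordAD coordAZ.
Qed.

(** Multiplying on the left by a Gram matrix evaluates the form: expand
    [a * basisA q] in the basis, whose coordinates are column [q] of [rhoA a]. *)
Lemma matT_rhoA n (a : algA n) (p q : 'I_(sizeS n)) :
  (matT n *m rhoA a) p q = sum_coord (basisA p * (a * basisA q)).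
Proof.
rewrite [a * _ in RHS]algA_decomp mulr_sumr mxE.
under [in RHS]eq_bigr do rewrite -algA_scaleAr.
rewrite sum_coord_linear_comb; apply: eq_bigr => i _.
by rewrite matT_gram [rhoA a i q]mxE mulrC.
Qed.

Theorem proposition2p19 (n : nat) (n_gt0 : (0 < n)%N) (a : algA n) :
  (matT n *m rhoA a)^T = matT n *m rhoA a.
Proof.
apply/matrixP => p q; rewrite mxE !matT_rhoA.
by rewrite mulrCA [in RHS]mulrCA [basisA q * _]mulrC.
Qed.
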